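(* There exists a non-adaptive tester for $k$-monotonicity of functions $f\colon[n]^d\to\{0,1\}$ with query complexity $q(n,d,\varepsilon,k)=\min\left(\tilde{O}\!\left(\frac{1}{\varepsilon^2}\left(\frac{5kd}{\varepsilon}\right)^d\right),\ 2^{\tilde{O}(k\sqrt{d}/\varepsilon^2)}\right)$.
   Context: $[n]^d$ is ordered coordinatewise. A function $f\colon[n]^d\to\{0,1\}$ is $k$-monotone if there do not exist $x_1\preceq\cdots\preceq x_{k+1}$ with $f(x_1)=1$ and $f(x_i)\neq f(x_{i+1})$ for all $i\in[k]$. Distance is normalized Hamming distance $\Pr_x[f(x)\neq g(x)]$ over uniform $x\in[n]^d$. A tester, given $\varepsilon$ and query access to $f$, accepts $k$-monotone $f$ with probability at least $2/3$ and rejects $f$ that is $\varepsilon$-far from $k$-monotone with probability at least $2/3$; non-adaptive means queries do not depend on previous answers. $\tilde{O}$ hides polylogarithmic factors. *)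

(* Defs.v *)
From HB Require Import structures.
From mathcomp Require Import all_boot all_order all_algebra.
From mathcomp Require Import reals exp.
Set Implicit Arguments. Unset Strict Implicit. Unset Printing Implicit Defensive.
Import Order.TTheory GRing.Theory Num.Theory.
Local Open Scope ring_scope.

Definition grid (n d : nat) := {ffun 'I_d -> 'I_n}.

Definition gle (n d : nat) (x y : grid n d) : bool :=
  [forall i, (x i <= y i)%N].

Definition k_monotone (n d k : nat) (f : grid n d -> bool) : Prop :=
  ~ exists x : nat -> grid n d,
      [/\ (forall i, (i < k)%N -> gle (x i) (x i.+1)),
          f (x 0%N) = true &
          (forall i, (i < k)%N -> f (x i) != f (x i.+1))].

Definition dist (R : realType) (n d : nat) (f g : grid n d -> bool) : R :=
  #|[set x : grid n d | f x != g x]|%:R / #|{: grid n d}|%:R.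

Definition far_from_k_monotone (R : realType) (n d k : nat) (eps : R)
    (f : grid n d -> bool) : Prop :=
  forall g : grid n d -> bool, k_monotone k g -> eps <= dist R f g.

(* A non-adaptive randomized tester making q queries: a probability
   distribution w on a finite space Omega of random seeds; on seed om the
   tester queries the points Q om 0, ..., Q om (q-1) (chosen independently of
   any answers) and outputs D om applied to the vector of answers. *)
Definition accept_prob (R : realType) (n d q : nat) (Omega : finType)
    (w : Omega -> R) (Q : Omega -> 'I_q -> grid n d)
    (D : Omega -> {ffun 'I_q -> bool} -> bool) (f : grid n d -> bool) : R :=
  \sum_(om : Omega) w om * (D om [ffun i => f (Q om i)])%:R.

Definition is_nonadaptive_kmono_tester (R : realType) (n d k q : nat) (eps : R)
    (Omega : finType) (w : Omega -> R) (Q : Omega -> 'I_q -> grid n d)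
    (D : Omega -> {ffun 'I_q -> bool} -> bool) : Prop :=
  [/\ (forall om, 0 <= w om),
      \sum_(om : Omega) w om = 1,
      (forall f, k_monotone k f -> 2 / 3 <= accept_prob w Q D f) &
      (forall f, far_from_k_monotone k eps f -> 2 / 3 <= 1 - accept_prob w Q D f)].

Definition softO_bound (R : realType) (C c : nat) (g : R) : R :=
  C%:R * g * (ln (2 + g)) ^+ c.

(* Main.v *)
Require Import Defs.
From HB Require Import structures.
From mathcomp Require Import all_boot all_order all_algebra.
From mathcomp Require Import boolp reals sequences exp.
From mathcomp Require Import ring lra zify.
Set Implicit Arguments. Unset Strict Implicit. Unset Printing Implicit Defensive.
Import Order.TTheory GRing.Theory Num.Theory.
Local Open Scope ring_scope.

(** Suppose a signature with N values is such that two k-monotone functions with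
    the same signature are eps/2-close.  Choosing one k-monotone representative
    per signature gives a cover of the class by its own members, and O(log N / eps)
    uniform samples tell whether some representative is close to f: by a Chernoff
    bound each far representative is refuted except with probability 1/(3N).

    For the first bound the signature is the restriction of f to the corners of
    m^d blocks, m = floor (5kd/eps).  A k-monotone f is the parity of the length
    of the longest alternating chain below x, hence a parity of k monotone
    functions, and rounding points down to block corners changes a monotone
    function on at most a d/m fraction of the points.

    For the second bound each of the k monotone functions is first rounded to
    the grid [2^a]^d, with 2^a about kd/eps.  Writing coordinates in binary gives a
    monotone bijection of this grid with the cube {0,1}^(da), so the function
    becomes monotone on the cube; it then has total influence O(sqrt (da)), and
    is determined up to distance O(sqrt (da) / t) by its Fourier coefficients of
    degree at most t.  Both testers have the form above; the cheaper one is used. *)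

(** * Testing by uniform samples *)

Lemma card_set_sum (T : finType) (P : pred T) :
  #|[set x | P x]| = (\sum_(x : T) P x)%N.
Proof. by rewrite -sum1dep_card big_mkcond; apply: eq_bigr => x _; case: (P x). Qed.

Section Sampling.
Variables (R : realType) (X : finType) (f h : X -> bool).

Definition mismatches (q : nat) (om : {ffun 'I_q -> X}) : nat :=
  #|[set i | f (om i) != h (om i)]|.

(** Independence of the samples: the sum over all sample vectors factors into [q] equal sums over a
    single point. *)
Lemma sum_pow_mismatches (q : nat) (b : R) :
  \sum_(om : {ffun 'I_q -> X}) b ^+ mismatches om
  = (#|X|%:R + #|[set x | f x != h x]|%:R * (b - 1)) ^+ q.
Proof.
have -> : #|X|%:R + #|[set x | f x != h x]|%:R * (b - 1)
  = \sum_(x : X) b ^+ (f x != h x) :> R.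
  rewrite card_set_sum -sum1_card !natr_sum mulr_suml -big_split /=.
  apply: eq_bigr => x _.
  by case: (f x != h x) => /=; ring.
rewrite -[q in RHS]card_ord -prodr_const bigA_distr_bigA /=.
apply: eq_bigr => om _; rewrite prodrXr; congr (_ ^+ _).
by rewrite /mismatches card_set_sum.
Qed.

(** A moment generating function bound obtained from [1 + y <= expR y]. Both signs of [l] occur
    later, one for each tail. *)
Lemma mean_exp_mismatches (q : nat) (l p : R) :
  (0 < #|X|)%N -> p * #|X|%:R = #|[set x | f x != h x]|%:R ->
  \sum_(om : {ffun 'I_q -> X})
     #|{: {ffun 'I_q -> X}}|%:R^-1 * expR (l * (mismatches om)%:R)
  <= expR (q%:R * (p * (expR l - 1))).
Proof.
move=> X0 pE; rewrite -mulr_sumr.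
under eq_bigr do rewrite mulrC expRM_natl.
rewrite sum_pow_mismatches -pE card_ffun card_ord natrX.
have X1 : 0 < #|X|%:R :> R by rewrite ltr0n.
have -> : #|X|%:R + p * #|X|%:R * (expR l - 1)
  = #|X|%:R * (1 + p * (expR l - 1)) by ring.
rewrite exprMn mulKf ?expf_neq0 ?gt_eqF //.
rewrite expRM_natl lerXn2r ?nnegrE ?expR_ge0 ?expR_ge1Dx //.
have p0 : 0 <= p by rewrite -(pmulr_lge0 _ X1) pE.
have p1 : p <= 1.
  by rewrite -(ler_pM2r X1) pE mul1r ler_nat max_card.
have := expR_gt0 l; nra.
Qed.

End Sampling.

Lemma expR_quarter_le (R : realType) : expR (1 / 4) <= 4 / 3 :> R.
Proof.
have h : 3 / 4 <= expR (- (1 / 4)) :> R by apply: le_trans (expR_ge1Dx _); lra.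
rewrite -[1/4]opprK expRN -[4/3]invrK lef_pV2 ?posrE ?expR_gt0 //; last lra.
by rewrite invf_div.
Qed.

Lemma expR_Nquarter_le (R : realType) : expR (- (1 / 4)) <= 4 / 5 :> R.
Proof.
have h : 5 / 4 <= expR (1 / 4) :> R by apply: le_trans (expR_ge1Dx _); lra.
rewrite expRN -[4/5]invrK lef_pV2 ?posrE ?expR_gt0 //; last lra.
by rewrite invf_div.
Qed.

Lemma dist_mulE (R : realType) (n d : nat) (f g : grid n d -> bool) :
  (0 < n)%N ->
  dist R f g * #|{: grid n d}|%:R = #|[set x | f x != g x]|%:R.
Proof.
move=> n0; rewrite /dist mulfVK // pnatr_eq0 -lt0n card_ffun card_ord.
by rewrite expn_gt0 n0.
Qed.

(* The acceptance threshold 3/4 eps q lies between the means eps/2 q and eps q;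
   the exponent 1/4 in the Chernoff bounds works on both sides. *)
Lemma cover_tester (R : realType) (n d k q : nat) (eps : R) (S : finType)
    (sig : (grid n d -> bool) -> S) :
  (0 < n)%N -> 0 < eps ->
  (forall f g, k_monotone k f -> k_monotone k g -> sig f = sig g ->
     dist R f g <= eps / 2) ->
  (3 * #|S|)%:R <= expR (q%:R * eps / 80) ->
  exists (Omega : finType) (w : Omega -> R)
         (Q : Omega -> 'I_q -> grid n d)
         (D : Omega -> {ffun 'I_q -> bool} -> bool),
    is_nonadaptive_kmono_tester k eps w Q D.
Proof.
move=> n0 eps0 cover Sq.
(* Representatives are chosen classically; [None] marks the signatures that no k-monotone function
   has. *)
have [rep repP] : exists rep : S -> option (grid n d -> bool),
    (forall s h, rep s = Some h -> k_monotone k h) /\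
    (forall f, k_monotone k f ->
       exists2 h, rep (sig f) = Some h & k_monotone k h /\ sig h = sig f).
  exists (fun s => if pselect (exists h, k_monotone k h /\ sig h = s) is left e
                   then Some (projT1 (cid e)) else None); split.
    move=> s h; case: pselect => // e [<-]; by case: (cid e) => ? [].
  move=> f fk; case: pselect => [e|[]]; last by exists f.
  by exists (projT1 (cid e)) => //; case: (cid e) => ? [].
case: repP => rep_mono rep_sig.
pose Omega : finType := {ffun 'I_q -> grid n d}.
pose th : R := 3 / 4 * eps * q%:R.
pose D (om : Omega) (a : {ffun 'I_q -> bool}) := [exists s, 
  if rep s is Some h then #|[set i | a i != h (om i)]|%:R <= th else false].
have X0 : (0 < #|{: grid n d}|)%N by rewrite card_ffun card_ord expn_gt0 n0.
have O0 : 0 < #|Omega|%:R :> R by rewrite ltr0n card_ffun expn_gt0 X0.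
pose w (om : Omega) : R := #|Omega|%:R^-1.
have w0 om : 0 <= w om by rewrite invr_ge0 ltW.
have w1 : \sum_om w om = 1.
  by rewrite /w sumr_const -[_ *+ _]mulr_natr mulVf // gt_eqF.
pose Q (om : Omega) (i : 'I_q) := om i.
have mmE f h (om : Omega) :
    #|[set i | [ffun i => f (Q om i)] i != h (om i)]| = mismatches f h om.
  by congr #|pred_of_set _|; apply/setP => i; rewrite !inE ffunE.
have tail : expR (- (q%:R * eps / 80)) * (3 * #|S|)%:R <= 1 :> R.
  by rewrite expRN mulrC ler_pdivrMr ?expR_gt0 // mul1r.
have qe0 : 0 <= q%:R * eps by rewrite mulr_ge0 // ltW.
exists Omega, w, Q, D; split=> // f.
- move=> fk; have [h rh [hk hs]] := rep_sig f fk.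
  have := cover f h fk hk (esym hs); set p := dist R f h => pe.
  have p0 : 0 <= p by rewrite /p /dist divr_ge0.
  have S0 : 1 <= #|S|%:R :> R by rewrite ler1n; apply/card_gt0P; exists (sig f).
  suff fail : 1 - accept_prob w Q D f <= 1 / 3 by lra.
  rewrite -[X in X - _]w1 /accept_prob -sumrB.
  (* Exponential Markov inequality: rejection forces more than [th] mismatches with the
     representative of [sig f]. *)
  apply: (@le_trans _ _ (\sum_(om : Omega)
     expR (- (1 / 4) * th) * (w om * expR (1 / 4 * (mismatches f h om)%:R)))).
    apply: ler_sum => om _; rewrite mulrCA -expRD -[X in X - _]mulr1 -mulrBr.
    apply: ler_wpM2l => //.
    case DD : (D _ _); first by rewrite subrr expR_ge0.
    rewrite subr0 -[leLHS]expR0 ler_expR.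
    move/existsPn : DD => /(_ (sig f)); rewrite rh mmE -ltNge.
    by move=> ?; lra.
  rewrite -mulr_sumr.
  apply: (@le_trans _ _ (expR (- (q%:R * eps / 80)))).
    apply: (le_trans (ler_wpM2l (expR_ge0 _)
      (mean_exp_mismatches q (1/4) X0 (dist_mulE R f h n0)))).
    rewrite -expRD ler_expR /th -/p.
    have pb : p * (expR (1 / 4) - 1) <= eps / 2 * (1 / 3).
      apply: ler_pM => //; last by have := expR_quarter_le R; lra.
      by have := expR_ge1Dx (1 / 4 : R); lra.
    have := ler_wpM2l (ler0n R q) pb; lra.
  move: tail; rewrite natrM.
  have := ler_wpM2l (expR_ge0 (- (q%:R * eps / 80))) S0; lra.
- move=> ff.
  suff acc : accept_prob w Q D f <= 1 / 3 by lra.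
  apply: (@le_trans _ _ (\sum_(s : S) expR (- (q%:R * eps / 80)))); last first.
    rewrite sumr_const -[leLHS]mulr_natr; move: tail; rewrite natrM; lra.
  (* Union bound over the signatures, with the Markov bound for the lower tail applied to each
     representative. *)
  apply: (@le_trans _ _ (\sum_(s : S) \sum_(om : Omega)
      if rep s is Some h then
        expR (1 / 4 * th) * (w om * expR (- (1 / 4) * (mismatches f h om)%:R))
      else 0)).
    rewrite exchange_big /=; apply: ler_sum => om _.
    have pos s : 0 <= if rep s is Some h then
        expR (1 / 4 * th) * (w om * expR (- (1 / 4) * (mismatches f h om)%:R))
        else 0.
      by case: (rep s) => // h; rewrite !mulr_ge0 ?expR_ge0.
    case DD : (D _ _); last by rewrite mulr0 sumr_ge0.
    case/existsP : DD => s rs; rewrite (bigD1 s) //= mulr1.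
    case rE: (rep s) rs => [h|] //; rewrite mmE => le_th.
    apply: (@le_trans _ _
      (expR (1 / 4 * th) * (w om * expR (- (1 / 4) * (mismatches f h om)%:R)))).
      rewrite mulrCA -expRD -[X in X <= _]mulr1; apply: ler_wpM2l => //.
      by rewrite -[leLHS]expR0 ler_expR; lra.
    by rewrite lerDl sumr_ge0.
  apply: ler_sum => s _; case rE : (rep s) => [h|]; last first.
    by rewrite big1 // expR_ge0.
  have pe := ff h (rep_mono _ _ rE).
  rewrite -mulr_sumr.
  apply: (le_trans (ler_wpM2l (expR_ge0 _)
    (mean_exp_mismatches q (- (1/4)) X0 (dist_mulE R f h n0)))).
  rewrite -expRD ler_expR /th.
  (* Per unit of [q * eps] the threshold contributes [3/16] and the mean [-1/5], in total [-1/80].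
     The accepting side has more room: [1/6 - 3/16 = -1/48]. *)
  have pb : dist R f h * (expR (- (1 / 4)) - 1) <= - (eps * (1 / 5)).
    have := expR_Nquarter_le R; nra.
  have := ler_wpM2l (ler0n R q) pb; lra.
Qed.

(** * Levels of a k-monotone function *)

Lemma gle_refl (n d : nat) (x : grid n d) : gle x x.
Proof. exact/forallP. Qed.

Lemma gle_trans (n d : nat) (y x z : grid n d) : gle x y -> gle y z -> gle x z.
Proof.
move=> /forallP xy /forallP yz; apply/forallP => i.
exact: leq_trans (xy i) (yz i).
Qed.

Definition monotone (n d : nat) (f : grid n d -> bool) : Prop :=
  forall x y, gle x y -> f x -> f y.

(* [level f j x]: some chain below x carries the values 1, 0, 1, ... (j terms). *)
Fixpoint level (n d : nat) (f : grid n d -> bool) (j : nat) (x : grid n d) :=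
  if j is j'.+1 then [exists y, [&& gle y x, f y == odd j & level f j' y]]
  else true.

Section Levels.
Variables (n d : nat).
Implicit Types (f g : grid n d -> bool) (x y : grid n d).

Lemma level_monotone f j : monotone (level f j).
Proof.
case: j => [|j] x y xy //= /existsP[z /and3P[zx fz lz]].
by apply/existsP; exists z; rewrite (gle_trans zx xy) fz.
Qed.

(** Otherwise [x] itself would extend the chain by one term. *)
Lemma level_parity f j x : level f j x -> ~~ level f j.+1 x -> f x = odd j.
Proof.
move=> lj /= /existsPn/(_ x); rewrite gle_refl lj andbT /=.
by case: (f x) (odd j) => [] [].
Qed.

Lemma level_chain f j x : level f j.+1 x ->
  exists s : nat -> grid n d,
    [/\ (forall i, (i < j)%N -> gle (s i) (s i.+1)),
        (forall i, (i <= j)%N -> f (s i) = odd i.+1) & gle (s j) x].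
Proof.
elim: j x => [|j IH] x /existsP[y /and3P[yx /eqP fy ly]].
  by exists (fun=> y); split=> // -[].
have [s [s_le fs sy]] := IH y ly.
exists (fun i => if (i <= j)%N then s i else y); split => [i|i|].
- rewrite ltnS => ij; rewrite ij; case: ltnP => [|ji]; first exact: s_le.
  by have -> : i = j by apply/eqP; rewrite eqn_leq ij.
- rewrite leq_eqVlt => /predU1P[->|]; first by rewrite ltnn fy.
  by rewrite ltnS => ij; rewrite ij fs.
- by rewrite ltnn.
Qed.

Lemma k_monotone_level k f x : k_monotone k f -> ~~ level f k.+1 x.
Proof.
move=> fk; apply/negP => /level_chain[s [s_le fs _]]; apply: fk.
exists s; split=> // [|i ik]; first by rewrite fs.
by rewrite !fs ?(ltnW ik) //=; case: (odd i).
Qed.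

(** The value [f x] is the parity of the last level that holds at [x], and that level is at most
    [k]. Two functions and two points are allowed so that the lemma serves both for rounding one
    function and for comparing two functions at one point. *)
Lemma level_separates k f g x y : k_monotone k f -> k_monotone k g ->
  f x != g y -> exists j : 'I_k, level f j.+1 x != level g j.+1 y.
Proof.
move=> fk gk fg; apply: contrapT => /forallNP same; case/eqP: fg.
have {}same j : (j <= k)%N -> level f j x = level g j y.
  by case: j => // j jk; case: (eqVneq (level f j.+1 x) (level g j.+1 y)) => // /(same (Ordinal jk)).
have ex_drop : exists j, ~~ level f j x by exists k.+1; exact: k_monotone_level.
case: (ex_minnP ex_drop) => -[|j] // lSj min_j.
have lj : level f j x by apply: contraT => /min_j; rewrite ltnn.
have jk : (j <= k)%N by have := min_j _ (k_monotone_level x fk).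
rewrite (level_parity lj lSj); apply/esym/level_parity; first by rewrite -same.
move: jk; rewrite leq_eqVlt => /predU1P[->|jk]; first exact: k_monotone_level.
by rewrite -same.
Qed.
End Levels.

(** * Rounding to a coarser grid *)

Lemma divn_ltn (a b : nat) (j : 'I_(a * b)) : (j %/ b < a)%N.
Proof.
by case: j => j /=; case: b => [|b]; rewrite ?muln0 // ltn_divLR.
Qed.

Definition ord_div (a b : nat) (j : 'I_(a * b)) : 'I_a := Ordinal (divn_ltn j).

Lemma card_ord_div (a b : nat) (x : 'I_a) : #|[set j : 'I_(a * b) | ord_div j == x]| = b.
Proof.
have lt_ab (r : 'I_b) : (x * b + r < a * b)%N.
  apply: (@leq_trans (x.+1 * b)); first by rewrite mulSn addnC ltn_add2r.
  by rewrite leq_pmul2r // (leq_ltn_trans _ (ltn_ord r)).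
rewrite -[RHS]card_ord -(card_imset _ (_ : injective (fun r => Ordinal (lt_ab r)))).
  apply: eq_card => j; rewrite inE; apply/eqP/imsetP => [jx|[r _ ->]].
    have b_gt0 : (0 < b)%N.
      by rewrite lt0n; apply/eqP => b0; case: (j) => /= ?; rewrite b0 muln0.
    exists (Ordinal (ltn_pmod j b_gt0)) => //; apply: val_inj => /=.
    by rewrite -jx /= -divn_eq.
  apply: val_inj => /=; rewrite divnMDl ?divn_small ?addn0 //.
  exact: leq_ltn_trans (ltn_ord r).
by move=> r s [] /addnI /val_inj.
Qed.

Lemma card_grid (n d : nat) : #|grid n d| = (n ^ d)%N.
Proof. by rewrite card_ffun !card_ord. Qed.

Definition gmap (n n' d : nat) (p : 'I_n -> 'I_n') (y : grid n d) : grid n' d :=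
  [ffun i => p (y i)].

(** A fibre of [gmap p] is a product of [d] fibres of [p]. *)
Lemma card_gmap_preim (n n' d s : nat) (p : 'I_n -> 'I_n') (P : pred (grid n' d)) :
  (forall x, #|[set j | p j == x]| = s) ->
  #|[set y | P (gmap p y)]| = (s ^ d * #|[set x | P x]|)%N.
Proof.
move=> ps; rewrite !card_set_sum big_distrr /=.
rewrite (partition_big (gmap p) xpredT) //=; apply: eq_bigr => x _.
rewrite (eq_bigr (fun=> P x : nat)); last by move=> y /eqP ->.
rewrite sum_nat_const; congr (_ * _)%N.
transitivity #|[set y | gmap p y == x]|; first by rewrite cardsE.
transitivity #|family (fun i => [set j | p j == x i])|.
  apply: eq_card => y; rewrite in_set; apply/idP/familyP => [/eqP <- i|yx].
    by rewrite inE ffunE.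
  by apply/eqP/ffunP => i; rewrite ffunE; have := yx i; rewrite inE => /eqP.
rewrite card_family foldrE big_image /=.
by under eq_bigr do rewrite ps; rewrite prod_nat_const card_ord.
Qed.

(** The slab is a product set with at most [n] choices in coordinate [i]. The extra factor [N]
    avoids the exponent [d - 1]. *)
Lemma card_top_slab (N n d : nat) (i : 'I_d) :
  (n <= N)%N -> (#|[set z : grid N d | N <= z i + n]| * N <= n * N ^ d)%N.
Proof.
move=> nN.
have slab1 : (#|[pred t : 'I_N | N <= t + n]| <= n)%N.
  rewrite -[leqRHS]card_ord.
  apply: leq_trans (leq_imset_card (fun j : 'I_n => rev_ord (widen_ord nN j)) _).
  apply: subset_leq_card; apply/subsetP => t; rewrite inE => tn.
  have tlt : (N - t.+1 < n)%N by have := ltn_ord t; lia.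
  apply/imsetP; exists (Ordinal tlt) => //; apply: val_inj => /=.
  by have := ltn_ord t; lia.
have -> : #|[set z : grid N d | N <= z i + n]%N|
    = (\prod_(j < d) #|if j == i then [pred t : 'I_N | (N <= t + n)%N] else predT|)%N.
  transitivity #|family (fun j => if j == i then [pred t : 'I_N | (N <= t + n)%N]
                                  else predT)|.
    apply: eq_card => z; rewrite inE; apply/idP/familyP => [zi j|/(_ i)].
      by case: eqP => [->|].
    by rewrite eqxx.
  by rewrite card_family foldrE big_image.
rewrite (bigD1 i) //= eqxx.
under eq_bigr => j /negbTE -> do rewrite card_ord.
have -> : (N ^ d = \prod_(j < d) N)%N by rewrite prod_nat_const card_ord.
rewrite -mulnA [in leqRHS](bigD1 i) //=.
by rewrite [X in (_ * X)%N]mulnC leq_mul.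
Qed.

(* m need not divide n: grid n d and grid m d are both quotients of
   grid (n * m) d with fibres of constant size. *)
Section Rounding.
Variables (n m d : nat).
Hypotheses (n_gt0 : (0 < n)%N) (m_gt0 : (0 < m)%N).

Lemma corner_ltn (j : 'I_(n * m)) : (j %/ n * n < n * m)%N.
Proof. exact: leq_ltn_trans (leq_divM _ _) (ltn_ord j). Qed.

Definition corner (j : 'I_(n * m)) : 'I_(n * m) := Ordinal (corner_ltn j).

Lemma gle_corner (y : grid (n * m) d) : gle (gmap corner y) y.
Proof. by apply/forallP => i; rewrite ffunE leq_divM. Qed.

(* Shifting by n in every coordinate sends y above the corner of its block, so
   rounding down loses at most the points lying within n of the upper faces. *)
Lemma card_neq_corner (g : grid (n * m) d -> bool) : monotone g ->
  (#|[set y | g y != g (gmap corner y)]| * m <= d * (n * m) ^ d)%N.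
Proof.
move=> g_mono.
pose low := [set y | g (gmap corner y)].
pose face i := [set z : grid (n * m) d | n * m <= z i + n]%N.
have sub : low \subset [set y | g y].
  by apply/subsetP => y; rewrite !inE; apply: g_mono; exact: gle_corner.
have -> : [set y | g y != g (gmap corner y)] = [set y | g y] :\: low.
  apply/setP => y; rewrite !inE; have /subsetP/(_ y) := sub; rewrite !inE.
  by case: (g y) (g _) => [] [] // ->.
have shift_lt (z : grid (n * m) d) : z \notin \bigcup_i face i ->
    forall i, (z i + n < n * m)%N.
  move=> zN i; rewrite ltnNge; apply: contra zN => ge.
  by apply/bigcupP; exists i => //; rewrite inE.
have nm_gt0 : (0 < n * m)%N by rewrite muln_gt0 n_gt0.
(* The default of [insubd] is reached only on the faces, which are excluded below. *)
pose shift (z : grid (n * m) d) : grid (n * m) d :=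
  [ffun i => insubd (Ordinal nm_gt0) (z i + n)%N].
have card_low : (#|[set y | g y] :\: \bigcup_i face i| <= #|low|)%N.
  rewrite -(card_in_imset (f := shift)).
    apply: subset_leq_card; apply/subsetP => _ /imsetP[z + ->].
    rewrite !inE => /andP[/shift_lt zlt]; apply: g_mono.
    apply/forallP => i; rewrite !ffunE /= val_insubd zlt.
    rewrite divnDr // divnn n_gt0 mulnDl mul1n.
    by rewrite {1}(divn_eq (z i) n) leq_add2l ltnW // ltn_pmod.
  move=> z z'; rewrite !inE => /andP[/shift_lt zlt _] /andP[/shift_lt zlt' _].
  move=> /ffunP E; apply/ffunP => i; apply: val_inj; have := E i.
  rewrite !ffunE => /(congr1 val); rewrite !val_insubd zlt zlt'; exact: addIn.
have bad_le : (#|[set y | g y] :\: low| <= #|\bigcup_i face i|)%N.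
  have := cardsID low [set y | g y]; rewrite (setIidPr sub).
  have := cardsID (\bigcup_i face i) [set y | g y].
  have := subset_leq_card (subsetIr [set y | g y] (\bigcup_i face i)).
  by lia.
(* The factor [n] turns [m] into the side length [n * m] of the slab bound. *)
rewrite -(leq_pmul2l n_gt0) mulnCA.
apply: (@leq_trans ((\sum_i #|face i|) * (n * m))%N).
  rewrite leq_mul //; apply: leq_trans bad_le _; elim/big_rec2: _ => [|i a A _ leA]; first by rewrite cards0.
  by rewrite (leq_trans (leq_card_setU _ _)) // leq_add2l.
rewrite big_distrl /=; apply: leq_trans (_ : \sum_(i < d) n * (n * m) ^ d <= _)%N.
  by apply: leq_sum => i _; apply: card_top_slab; rewrite leq_pmulr.
by rewrite sum_nat_const card_ord mulnCA.
Qed.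

Definition cell (j : 'I_(n * m)) : 'I_n := ord_div j.

Definition block (j : 'I_(n * m)) : 'I_m := ord_div (cast_ord (mulnC n m) j).

Lemma embed_ltn (b : 'I_m) : (b * n %/ m < n)%N.
Proof. by rewrite ltn_divLR // mulnC ltn_pmul2l. Qed.

(** The cell that contains the lower end [b * n] of block [b] in the common refinement. *)
Definition embed (b : 'I_m) : 'I_n := Ordinal (embed_ltn b).

Definition coarse (f : grid n d -> bool) (b : grid m d) : bool := f (gmap embed b).

Lemma cell_corner (y : grid (n * m) d) :
  gmap cell (gmap corner y) = gmap embed (gmap block y).
Proof. by apply/ffunP => i; rewrite !ffunE; apply: val_inj. Qed.

Lemma card_block (x : 'I_m) : #|[set j | block j == x]| = n.
Proof.
rewrite -[RHS](card_ord_div n x) -[RHS](on_card_preimset (f := cast_ord (mulnC n m))).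
  by apply: eq_card => j; rewrite !inE.
by apply: onW_bij; exists (cast_ord (esym (mulnC n m))); [exact: cast_ordK | exact: cast_ordKV].
Qed.

Definition rounding_errors (f : grid n d -> bool) : nat :=
  #|[set y : grid (n * m) d | f (gmap cell y) != coarse f (gmap block y)]|.

Lemma rounding_errors_monotone (f : grid n d -> bool) : monotone f ->
  (rounding_errors f * m <= d * (n * m) ^ d)%N.
Proof.
move=> f_mono; rewrite /rounding_errors /coarse.
under [X in #|pred_of_set X|]eq_finset => y do rewrite -cell_corner.
apply: (card_neq_corner (g := fun y => f (gmap cell y))) => x y xy.
by apply: f_mono; apply/forallP => i; rewrite !ffunE leq_div2r // (forallP xy).
Qed.

Lemma rounding_errors_k_monotone k (f : grid n d -> bool) : k_monotone k f ->
  (rounding_errors f * m <= k * (d * (n * m) ^ d))%N.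
Proof.
move=> fk.
apply: (@leq_trans ((\sum_(j < k) rounding_errors (level f j.+1)) * m)%N).
  rewrite leq_mul //.
  apply: (@leq_trans #|\bigcup_(j < k)
      [set y | level f j.+1 (gmap cell y) != coarse (level f j.+1) (gmap block y)]|).
    apply: subset_leq_card; apply/subsetP => y; rewrite inE.
    move=> /(level_separates fk fk)[j jP]; apply/bigcupP; exists j => //.
    by rewrite inE.
  elim/big_rec2: _ => [|i a A _ leA]; first by rewrite cards0.
  by rewrite (leq_trans (leq_card_setU _ _)) // leq_add2l.
rewrite big_distrl /=; apply: leq_trans (_ : \sum_(j < k) d * (n * m) ^ d <= _)%N.
  by apply: leq_sum => j _; exact: rounding_errors_monotone (@level_monotone n d f j.+1).
by rewrite sum_nat_const card_ord.
Qed.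

(** Triangle inequality on the common refinement, passing from [f] to [coarse f] to [coarse g] to
    [g]. *)
Lemma dist_coarse (R : realType) (c : nat) (f g : grid n d -> bool) :
  (rounding_errors f * m <= c * (n * m) ^ d)%N ->
  (rounding_errors g * m <= c * (n * m) ^ d)%N ->
  dist R f g <= 2 * c%:R / m%:R + dist R (coarse f) (coarse g).
Proof.
move=> fc gc.
have split_neq : (m ^ d * #|[set x | f x != g x]| <= rounding_errors f
    + rounding_errors g + n ^ d * #|[set b | coarse f b != coarse g b]|)%N.
  rewrite -(card_gmap_preim (fun x => f x != g x) (card_ord_div (a := n) m)).
  rewrite -(card_gmap_preim (fun b => coarse f b != coarse g b) card_block).
  apply: leq_trans (leq_trans (leq_card_setU _ _) (leq_add (leq_card_setU _ _) (leqnn _))).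
  apply: subset_leq_card; apply/subsetP => y; rewrite !inE.
  by case: (f _) (g _) (coarse f _) (coarse g _) => [] [] [] [].
have n0 : 0 < n%:R ^+ d :> R by rewrite exprn_gt0 // ltr0n.
have m0 : 0 < m%:R ^+ d :> R by rewrite exprn_gt0 // ltr0n.
have m1 : 0 < m%:R :> R by rewrite ltr0n.
have nm0 : 0 < n%:R ^+ d * m%:R ^+ d :> R by rewrite mulr_gt0.
have Df := dist_mulE R f g n_gt0; have Dg := dist_mulE R (coarse f) (coarse g) m_gt0.
rewrite !card_grid !natrX in Df Dg.
rewrite -(ler_pM2r nm0).
rewrite [leLHS](_ : _ = m%:R ^+ d * (dist R f g * n%:R ^+ d)); last by ring.
rewrite [leRHS](_ : _ = 2 * c%:R / m%:R * (n%:R ^+ d * m%:R ^+ d)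
  + n%:R ^+ d * (dist R (coarse f) (coarse g) * m%:R ^+ d)); last by ring.
rewrite {}Df {}Dg.
move: split_neq fc gc; rewrite expnMn -!(ler_nat R) !natrD !natrM !natrX => h hf hg.
have ineq (a : nat) :
    a%:R * m%:R <= c%:R * (n%:R ^+ d * m%:R ^+ d) :> R ->
    a%:R <= c%:R / m%:R * (n%:R ^+ d * m%:R ^+ d) :> R.
  by move=> ha; rewrite mulrAC ler_pdivlMr // ha.
by move: h (ineq _ hf) (ineq _ hg) => *; lra.
Qed.

Lemma dist_block_constant (R : realType) k (f g : grid n d -> bool) :
  k_monotone k f -> k_monotone k g -> coarse f =1 coarse g ->
  dist R f g <= 2 * (k * d)%:R / m%:R.
Proof.
move=> fk gk fg.
apply: le_trans (dist_coarse R (c := (k * d)%N) _ _) _.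
- by rewrite -mulnA; exact: rounding_errors_k_monotone.
- by rewrite -mulnA; exact: rounding_errors_k_monotone.
rewrite [X in _ + X](_ : _ = 0) ?addr0 //.
rewrite /dist (_ : [set x | _] = set0) ?cards0 ?mul0r //.
by apply/setP => b; rewrite !inE fg eqxx.
Qed.

End Rounding.

(** * Fourier analysis of monotone functions on the cube *)

Section Cube.
Variables (R : realType) (I : finType).
Implicit Types (x y : {ffun I -> bool}) (F : {ffun I -> bool} -> R) (S : {set I}).
Local Notation V := {ffun I -> bool}.
Local Notation N := (2%:R ^+ #|I| : R).

Definition chi S x : R := \prod_(i in S) (-1) ^+ x i.

(** Walsh coefficients without normalization, so Parseval carries the factor [N]. *)
Definition fourier F S : R := \sum_x F x * chi S x.

Definition flip (i : I) x : V := [ffun j => x j (+) (j == i)].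

Lemma flipK i : involutive (flip i).
Proof. by move=> x; apply/ffunP => j; rewrite !ffunE -addbA addbb addbF. Qed.

Lemma sum_flip i F : \sum_x F (flip i x) = \sum_x F x.
Proof. by rewrite [RHS](reindex_inj (inv_inj (flipK i))). Qed.

(** The sum over [S] expands a product over the coordinates whose factor is 2 where [x] and [y]
    agree and 0 where they differ. *)
Lemma sum_chi_mul x y : \sum_S chi S x * chi S y = (x == y)%:R * N.
Proof.
transitivity (\sum_(S : {set I}) \prod_i
    (if i \in S then (-1) ^+ x i * (-1) ^+ y i else 1 : R)).
  by apply: eq_bigr => S _; rewrite -big_split /= [LHS]big_mkcond.
rewrite -bigA_distr /=.
have [->|neq] := eqVneq x y.
  rewrite mul1r -prodr_const; apply: eq_bigr => i _.
  by rewrite -signr_addb addbb.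
have /existsP[i xi] : [exists i, x i != y i].
  apply: contraNT neq => /existsPn xy; apply/eqP/ffunP => i.
  by have := xy i; rewrite negbK => /eqP.
rewrite (bigD1 i) //= mul0r; move: xi.
by case: (x i) (y i) => [] [] //= _; rewrite ?expr0 ?expr1 ?mulr1 ?mul1r addNr mul0r.
Qed.

Lemma parseval F : \sum_S fourier F S ^+ 2 = N * \sum_x F x ^+ 2.
Proof.
transitivity (\sum_S \sum_x \sum_y F x * F y * (chi S x * chi S y)).
  apply: eq_bigr => S _; rewrite expr2 big_distrlr /=.
  by apply: eq_bigr => x _; apply: eq_bigr => y _; ring.
rewrite exchange_big /= mulr_sumr; apply: eq_bigr => x _.
rewrite exchange_big /=; under eq_bigr do rewrite -mulr_sumr sum_chi_mul.
rewrite (bigD1 x) //= [X in _ + X]big1 => [|y yx]; first by rewrite eqxx mul1r addr0 mulrC expr2.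
by rewrite eq_sym (negbTE yx) mul0r mulr0.
Qed.

Lemma chi_flip i S x : chi S (flip i x) = (-1) ^+ (i \in S) * chi S x.
Proof.
have [iS|iS] := boolP (i \in S); last first.
  rewrite mul1r; apply: eq_bigr => j jS; rewrite ffunE.
  by case: eqP jS => [->|]; rewrite ?(negbTE iS) ?addbF.
rewrite /chi (bigD1 i) //= [in RHS](bigD1 i) //= ffunE eqxx signr_addb.
rewrite mulrA [X in X * _]mulrC; congr (_ * _); apply: eq_bigr => j /andP[_ ji].
by rewrite ffunE (negbTE ji) addbF.
Qed.

(** Differencing in direction [i] doubles the coefficients with [i] in [S] and kills the others;
    Parseval summed over [i] then counts each [S] with weight [4 * #|S|]. *)
Lemma total_influence F :
  N * \sum_i \sum_x (F x - F (flip i x)) ^+ 2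
  = 4 * \sum_(S : {set I}) #|S|%:R * fourier F S ^+ 2.
Proof.
have deriv i S : fourier (fun x => F x - F (flip i x)) S
    = 2 * (i \in S)%:R * fourier F S.
  rewrite /fourier; under eq_bigr do rewrite mulrBl.
  rewrite sumrB -[X in _ - X](sum_flip i).
  under [X in _ - X]eq_bigr do rewrite flipK chi_flip mulrCA.
  rewrite -[X in _ - X]mulr_sumr.
  by case: (i \in S); rewrite ?expr1 ?expr0 /=; ring.
rewrite mulr_sumr; under eq_bigr do rewrite -parseval.
rewrite exchange_big mulr_sumr; apply: eq_bigr => S _ /=.
under eq_bigr do rewrite deriv exprMn exprMn.
rewrite -mulr_suml -mulr_sumr mulrA; congr (_ * _); congr (_ * _); first by ring.
rewrite -sum1_card natr_sum [RHS]big_mkcond; apply: eq_bigr => i _ /=.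
by case: (i \in S); rewrite /= ?expr1n ?expr0n.
Qed.

Definition cube_monotone (f : V -> bool) : Prop :=
  forall x y, (forall i, x i ==> y i) -> f x -> f y.

Lemma sum_sign_sqr :
  \sum_(x : V) (\sum_i (-1) ^+ x i) ^+ 2 = N * #|I|%:R :> R.
Proof.
transitivity (\sum_i \sum_j \sum_(x : V) (-1) ^+ x i * (-1) ^+ x j : R).
  under eq_bigr do rewrite expr2 big_distrlr /=.
  by rewrite exchange_big /=; apply: eq_bigr => i _; exact: exchange_big.
have -> : #|I|%:R = \sum_(i : I) 1 :> R by rewrite sumr_const.
rewrite mulr_sumr; apply: eq_bigr => i _.
rewrite (bigD1 i) //= [X in _ + X]big1 => [|j ji].
  under eq_bigr do rewrite -signr_addb addbb expr0.
  by rewrite addr0 sumr_const card_ffun card_bool natrX mulr1.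
set s := \sum_x _; suff : s = - s by move=> ?; lra.
rewrite /s -[LHS](sum_flip i) -sumrN; apply: eq_bigr => x _.
by rewrite !ffunE eqxx (negbTE ji) addbT addbF signrN mulNr.
Qed.

(* For monotone f the influence of i is the level-one coefficient of i up to
   sign, so the total influence is a correlation of f with the sum of the
   coordinate signs, which has typical size sqrt #|I|. *)
Lemma monotone_total_influence (f : V -> bool) (r : R) : cube_monotone f -> 0 < r ->
  \sum_i \sum_x ((f x)%:R - (f (flip i x))%:R) ^+ 2 <= N * (#|I|%:R / r + r).
Proof.
move=> f_mono r0.
(* By monotonicity [x i] fixes the sign of the difference, which therefore equals its own square up
   to that sign. *)
have infl i x : ((f x)%:R - (f (flip i x))%:R) ^+ 2
    = (f (flip i x))%:R * (-1) ^+ x i - (f x)%:R * (-1) ^+ x i :> R.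
  case xi : (x i).
    have : f (flip i x) -> f x.
      apply: f_mono => j; rewrite ffunE; case: eqP => [->|_]; rewrite ?xi //.
      by rewrite addbF implybb.
    by case: (f x) (f (flip _ _)) => [] [] /= h; rewrite ?expr1; try ring; have := h isT.
  have : f x -> f (flip i x).
    apply: f_mono => j; rewrite ffunE; case: eqP => [->|_]; rewrite ?xi //.
    by rewrite addbF implybb.
  by case: (f x) (f (flip _ _)) => [] [] /= h; rewrite ?expr0; try ring; have := h isT.
have infl_sum i : \sum_x ((f x)%:R - (f (flip i x))%:R) ^+ 2
    = \sum_x (- 2 * (f x)%:R * (-1) ^+ x i) :> R.
  under eq_bigr do rewrite infl.
  rewrite sumrB -[X in X - _](sum_flip i) -sumrB; apply: eq_bigr => x _.
  by rewrite flipK ffunE eqxx addbT signrN; ring.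
under eq_bigr do rewrite infl_sum.
rewrite exchange_big /=.
apply: (@le_trans _ _ (\sum_(x : V) ((\sum_i (-1) ^+ x i) ^+ 2 / r + r))).
  apply: ler_sum => x _; rewrite -mulr_sumr; set s := \sum_i _.
  (* This replaces Cauchy-Schwarz; [r] is later set to the square root of [#|I|]. *)
  have amgm : - 2 * s <= s ^+ 2 / r + r.
    rewrite -(ler_pM2r r0) mulrDl divfK ?gt_eqF //.
    by have := sqr_ge0 (s + r); rewrite sqrrD; lra.
  case: (f x); first by rewrite mulr1.
  rewrite mulr0 mul0r addr_ge0 ?(ltW r0) // divr_ge0 ?sqr_ge0 ?(ltW r0) //.
rewrite big_split /= -mulr_suml sum_sign_sqr sumr_const card_ffun card_bool.
by rewrite -[r *+ _]mulr_natr natrX; lra.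
Qed.

(** Only degrees above [t] survive in [f - g], and there [t * (u - v)^2 <= #|S| * (2 u^2 + 2 v^2)].
    The two functions and the factor 2 use up the 4 of the influence formula. *)
Lemma low_degree_agreement (f g : V -> bool) (t : nat) (r : R) :
  cube_monotone f -> cube_monotone g -> 0 < r ->
  (forall S, (#|S| <= t)%N ->
     fourier (fun x => (f x)%:R) S = fourier (fun x => (g x)%:R) S) ->
  #|[set x | f x != g x]|%:R * t%:R <= N * (#|I|%:R / r + r).
Proof.
move=> f_mono g_mono r0 low.
have N0 : 0 < N by rewrite exprn_gt0.
have concentration (h : V -> bool) : cube_monotone h ->
    4 * \sum_(S : {set I}) #|S|%:R * fourier (fun x => (h x)%:R) S ^+ 2
    <= N * (N * (#|I|%:R / r + r)).
  by move=> h_mono; rewrite -total_influence ler_wpM2l ?(ltW N0) // monotone_total_influence.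
have -> : #|[set x | f x != g x]|%:R = \sum_x ((f x)%:R - (g x)%:R) ^+ 2 :> R.
  rewrite card_set_sum natr_sum; apply: eq_bigr => x _.
  by case: (f x) (g x) => [] []; rewrite /= ?subrr ?subr0 ?sub0r ?sqrrN ?expr0n ?expr1n.
rewrite -(ler_pM2l N0) mulrA -parseval mulr_suml.
have := concentration f f_mono; have := concentration g g_mono.
set E := N * (N * _) => hg hf.
apply: (@le_trans _ _ (\sum_(S : {set I}) (2 * (#|S|%:R * fourier (fun x => (f x)%:R) S ^+ 2)
                         + 2 * (#|S|%:R * fourier (fun x => (g x)%:R) S ^+ 2)))).
  apply: ler_sum => S _.
  have -> : fourier (fun x => (f x)%:R - (g x)%:R) S
      = fourier (fun x => (f x)%:R) S - fourier (fun x => (g x)%:R) S.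
    by rewrite -sumrB; apply: eq_bigr => x _; rewrite mulrBl.
  have [St|St] := leqP #|S| t.
    have pos (a : R) : 0 <= 2 * (#|S|%:R * a ^+ 2).
      by rewrite mulr_ge0 // mulr_ge0 // sqr_ge0.
    by rewrite low // subrr expr0n mul0r addr_ge0.
  set u := fourier (fun x => (f x)%:R) S; set v := fourier (fun x => (g x)%:R) S.
  have tS : t%:R <= #|S|%:R :> R by rewrite ler_nat ltnW.
  apply: (@le_trans _ _ ((u - v) ^+ 2 * #|S|%:R)).
    by rewrite ler_wpM2l // sqr_ge0.
  have : (u - v) ^+ 2 <= 2 * u ^+ 2 + 2 * v ^+ 2 by have := sqr_ge0 (u + v); lra.
  by move=> /(ler_wpM2r (ler0n R #|S|)); lra.
rewrite big_split /= -!mulr_sumr; lra.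
Qed.

End Cube.

(** * Low-degree signatures *)

Section LowDegreeSignature.
Variables (R : realType) (I : finType) (t : nat).
Local Notation V := {ffun I -> bool}.
Implicit Types (f g : V -> bool) (u : {ffun 'I_t -> option I}).

Definition positive_count f (S : {set I}) : nat :=
  #|[set x | f x && (chi R S x == 1)]|.

Definition values u : {set I} := [set i | [exists j, u j == Some i]].

(* The counts are recorded exactly, which multiplies the logarithm of the number
   of signatures by #|I| + 1 only; values u runs over all sets of size <= t. *)
Definition signature f : {ffun {ffun 'I_t -> option I} -> 'I_(2 ^ #|I|).+1} :=
  [ffun u => inord (positive_count f (values u))].

(** Characters take the values 1 and -1, and the count at [set0] is the size of the support of [f];
    so finitely many integers encode the coefficients. *)
Lemma fourier_count f S : fourier (fun x => (f x)%:R) S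
  = 2 * (positive_count f S)%:R - (positive_count f set0)%:R :> R.
Proof.
rewrite /positive_count !card_set_sum !natr_sum mulr_sumr -sumrB.
apply: eq_bigr => x _; rewrite [chi _ set0 x]big_set0 eqxx andbT.
have : chi R S x = 1 \/ chi R S x = -1.
  rewrite /chi; elim/big_rec: _ => [|i y _]; first by left.
  by case: (x i) => -[] ->; rewrite ?mulrN1 ?mulr1 ?opprK ?expr1 ?expr0; auto.
case=> ->; first by rewrite eqxx andbT; ring.
have -> : (-1 == 1 :> R) = false by apply/negbTE; rewrite lt_eqF //; lra.
by rewrite andbF /=; ring.
Qed.

Lemma values_onto (S : {set I}) : (#|S| <= t)%N -> exists u, values u = S.
Proof.
move=> St; exists [ffun j : 'I_t => nth None (map Some (enum S)) j].
apply/setP => i; rewrite inE; apply/existsP/idP => [[j]|iS].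
  rewrite ffunE; have [jS|jS] := ltnP j #|S|; last first.
    by rewrite nth_default // size_map -cardE.
  rewrite (nth_map i) -?cardE // => /eqP[<-].
  by rewrite -mem_enum mem_nth // -cardE.
have lt_t : (index i (enum S) < t)%N.
  by apply: leq_trans St; rewrite cardE index_mem mem_enum.
exists (Ordinal lt_t); rewrite ffunE /= (nth_map i) ?nth_index ?mem_enum //.
by rewrite index_mem mem_enum.
Qed.

Lemma signature_fourier f g (S : {set I}) : signature f = signature g -> (#|S| <= t)%N ->
  fourier (fun x => (f x)%:R) S = fourier (fun x => (g x)%:R) S :> R.
Proof.
move=> fg St.
have count_eq (S' : {set I}) : (#|S'| <= t)%N -> positive_count f S' = positive_count g S'.
  move=> /values_onto[u <-]; have /ffunP/(_ u) := fg; rewrite !ffunE.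
  (* Counts are in range, so [inord] loses nothing. *)
  have bound h : (positive_count h (values u) < (2 ^ #|I|).+1)%N.
    by rewrite ltnS -card_bool -card_ffun max_card.
  by move/(congr1 (@nat_of_ord _)); rewrite !inordK.
by rewrite !fourier_count !count_eq // cards0.
Qed.

End LowDegreeSignature.

(** * Binary digits: the dyadic grid as a cube *)

Section BinaryDigits.
Variables (a d : nat).

Definition digits (x : grid (2 ^ a) d) : {ffun 'I_d * 'I_a -> bool} :=
  [ffun p : 'I_d * 'I_a => odd (x p.1 %/ 2 ^ p.2)].

Lemma leq_digits (b x y : nat) : (x < 2 ^ b)%N ->
  (forall j, (j < b)%N -> odd (x %/ 2 ^ j) ==> odd (y %/ 2 ^ j)) -> (x <= y)%N.
Proof.
elim: b x y => [|b IH] x y; first by rewrite expn0 ltnS leqn0 => /eqP ->.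
move=> xb xy; rewrite -(odd_double_half x) -(odd_double_half y).
have := xy 0%N isT; rewrite expn0 !divn1 => odd_xy.
apply: leq_add; first by case: (odd x) odd_xy => //= ->.
rewrite leq_double; apply: IH => [|j jb].
  by rewrite -divn2 ltn_divLR // mulnC -expnS.
by have := xy j.+1 jb; rewrite expnS !divnMA !divn2.
Qed.

(** The converse fails in general. It is the decoding from cube to grid that is monotone, as pulling
    monotone functions back to the cube requires. *)
Lemma gle_digits (x y : grid (2 ^ a) d) :
  (forall p, digits x p ==> digits y p) -> gle x y.
Proof.
move=> xy; apply/forallP => i; apply: (@leq_digits a) => // j ja.
by have := xy (i, Ordinal ja); rewrite !ffunE.
Qed.

Lemma digits_bij : bijective digits.
Proof.
apply: inj_card_bij => [x y xy|].
  have le (z w : grid (2 ^ a) d) : digits z = digits w -> gle z w.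
    by move=> zw; apply: gle_digits => p; rewrite zw implybb.
  apply/ffunP => i; apply: val_inj; apply/eqP; rewrite eqn_leq.
  have /forallP/(_ i) -> := le x y xy; exact: (forallP (le y x (esym xy))).
by rewrite card_ffun card_prod !card_ord card_bool card_grid mulnC -expnM.
Qed.

End BinaryDigits.

(** * Fourier signatures of all levels of a k-monotone function *)

Lemma dist_levels (R : realType) (n d k : nat) (f g : grid n d -> bool) :
  k_monotone k f -> k_monotone k g ->
  dist R f g <= \sum_(j < k) dist R (level f j.+1) (level g j.+1).
Proof.
move=> fk gk; rewrite /dist -mulr_suml ler_wpM2r ?invr_ge0 // -natr_sum ler_nat.
apply: (@leq_trans #|\bigcup_(j < k) [set x | level f j.+1 x != level g j.+1 x]|).
  apply: subset_leq_card; apply/subsetP => x; rewrite inE.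
  move=> /(level_separates fk gk)[j jP]; apply/bigcupP; exists j => //.
  by rewrite inE.
elim/big_rec2: _ => [|i c A _ leA]; first by rewrite cards0.
by rewrite (leq_trans (leq_card_setU _ _)) // leq_add2l.
Qed.

(** Each level is rounded, pulled back to the cube and recorded by its low-degree signature. It
    costs one rounding term and one Fourier term. *)
Lemma k_monotone_signature (R : realType) (n d k a t : nat) :
  (0 < n)%N -> (0 < d)%N -> (0 < a)%N -> (0 < t)%N ->
  exists sig : (grid n d -> bool) ->
      {ffun 'I_k -> {ffun {ffun 'I_t -> option ('I_d * 'I_a)%type} ->
                      'I_(2 ^ #|{: 'I_d * 'I_a}|).+1}},
  forall f g, k_monotone k f -> k_monotone k g -> sig f = sig g ->
    dist R f g
    <= k%:R * (2 * d%:R / (2 ^ a)%:R + 2 * Num.sqrt (d * a)%:R / t%:R).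
Proof.
move=> n0 d0 a0 t0; have [dec digitsK decK] := digits_bij a d.
have m0 : (0 < 2 ^ a)%N by rewrite expn_gt0.
exists (fun f => [ffun j : 'I_k =>
  signature R t (fun v => coarse n0 m0 (level f j.+1) (dec v))]) => f g fk gk fg.
apply: le_trans (dist_levels R fk gk) _.
rewrite [leRHS](_ : _ = \sum_(j < k)
    (2 * d%:R / (2 ^ a)%:R + 2 * Num.sqrt (d * a)%:R / t%:R)); last first.
  by rewrite sumr_const card_ord -[RHS]mulr_natl.
apply: ler_sum => j _.
have mono h := @level_monotone n d h j.+1.
have err h := rounding_errors_monotone n0 m0 (mono h).
apply: le_trans (dist_coarse R (err f) (err g)) _.
rewrite lerD2l.
have cube_mono h : cube_monotone (fun v => coarse n0 m0 (level h j.+1) (dec v)).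
  move=> v w vw; apply: mono; apply/forallP => i; rewrite !ffunE.
  have /forallP/(_ i) le_vw : gle (dec v) (dec w).
    by apply: gle_digits => p; rewrite !decK.
  by apply: leq_div2r; rewrite leq_mul2r le_vw orbT.
(* This choice balances the two terms of the influence bound. *)
set r : R := Num.sqrt (d * a)%:R.
have r0 : 0 < r by rewrite sqrtr_gt0 ltr0n muln_gt0 d0.
have /ffunP/(_ j) := fg; rewrite !ffunE => sig_eq.
have := low_degree_agreement (cube_mono f) (cube_mono g) r0
  (fun S => signature_fourier (S := S) sig_eq).
set A := #|_|.
have -> : A = #|[set b | coarse n0 m0 (level f j.+1) b
                      != coarse n0 m0 (level g j.+1) b]|.
  rewrite /A -[LHS](on_card_preimset (f := @digits a d)); last by apply: onW_bij; exists dec.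
  by apply: eq_card => b; rewrite !inE digitsK.
rewrite -dist_mulE // card_grid card_prod !card_ord -natrX [(d * a)%N in X in X -> _]mulnC.
rewrite expnM -/r.
have N0 : 0 < ((2 ^ a) ^ d)%:R :> R by rewrite ltr0n expn_gt0 m0.
rewrite mulrAC mulrC ler_pM2l // => h.
rewrite ler_pdivlMr ?ltr0n // (le_trans h) // mulnC.
have rr : r * r = (d * a)%:R by rewrite -expr2 sqr_sqrtr.
by rewrite -rr mulfK ?gt_eqF //; lra.
Qed.

(** * Query complexity *)

Definition has_tester (R : realType) (n d k q : nat) (eps : R) : Prop :=
  exists (Omega : finType) (w : Omega -> R) (Q : Omega -> 'I_q -> grid n d)
         (D : Omega -> {ffun 'I_q -> bool} -> bool),
    is_nonadaptive_kmono_tester k eps w Q D.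

Lemma expR_half_le2 (R : realType) : expR (1 / 2) <= 2 :> R.
Proof.
have -> : 1 / 2 = 2%:R * (1 / 4) :> R by lra.
rewrite expRM_natl; have := expR_quarter_le R; have := expR_gt0 (1 / 4 : R).
by rewrite expr2; nra.
Qed.

Lemma expn2_le_expR (R : realType) (e : nat) : (2 ^ e)%:R <= expR e%:R :> R.
Proof.
rewrite natrX -[e%:R]mulr1 expRM_natl lerXn2r ?nnegrE ?expR_ge0 //.
by have := expR_ge1Dx (1 : R); lra.
Qed.

(** About [80 * (e + 2) / eps] samples suffice since [3 * 2^e <= 2^(e+2) <= exp (e+2)]. With
    [e + 2 <= 3 * e] and one more query for rounding up, the constant is [240 + 1]. *)
Lemma tester_of_cover (R : realType) (n d k e : nat) (eps : R) (S : finType)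
    (sig : (grid n d -> bool) -> S) :
  (0 < n)%N -> (0 < e)%N -> 0 < eps -> eps <= 1 ->
  (forall f g, k_monotone k f -> k_monotone k g -> sig f = sig g ->
     dist R f g <= eps / 2) ->
  (#|S| <= 2 ^ e)%N ->
  exists2 q : nat, q%:R <= 241 * (e%:R / eps) & has_tester n d k q eps.
Proof.
move=> n0 e0 eps0 eps1 cover Se.
have e1 : 1 <= e%:R :> R by rewrite ler1n.
have ee : e%:R <= e%:R / eps :> R.
  by rewrite ler_pdivlMr // ler_piMr.
have b0 : 0 <= 80 * ((e%:R + 2) / eps) :> R.
  by rewrite mulr_ge0 // divr_ge0 ?addr_ge0 // ltW.
exists (Num.trunc (80 * ((e%:R + 2) / eps))).+1.
  rewrite -natr1; have /andP[+ _] := truncn_itv b0.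
  have : (e%:R + 2) / eps <= 3 * (e%:R / eps).
    by rewrite mulrA ler_pM2r ?invr_gt0 //; lra.
  by move=> *; lra.
apply: cover_tester => //; first exact: cover.
apply: (@le_trans _ _ (expR (e + 2)%:R)).
  apply: le_trans (expn2_le_expR R (e + 2)); rewrite ler_nat expnD mulnC.
  by rewrite leq_mul.
rewrite ler_expR natrD ler_pdivlMr // -ler_pdivrMr //.
by apply: le_trans (ltW (truncnS_gt _)); rewrite mulrAC mulrC.
Qed.

Lemma block_tester (R : realType) (n d k : nat) (eps : R) :
  (0 < n)%N -> (0 < d)%N -> (0 < k)%N -> 0 < eps -> eps <= 1 ->
  exists2 q : nat, q%:R <= 241 * (((5 * k * d)%:R / eps) ^+ d / eps)
                 & has_tester n d k q eps.
Proof.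
move=> n0 d0 k0 eps0 eps1.
pose x : R := (k * d)%:R / eps.
have xE : (5 * k * d)%:R / eps = 5 * x by rewrite /x -mulnA natrM mulrA.
have x1 : 1 <= x.
  rewrite /x ler_pdivlMr // mul1r (le_trans eps1) // ler1n muln_gt0 k0.
  exact: d0.
have x5 : 0 <= 5 * x by lra.
set m := Num.trunc (5 * x).
have /andP[m_le m_gt] := truncn_itv x5; rewrite -/m -[m.+1%:R]natr1 in m_le m_gt.
have m0 : (0 < m)%N by rewrite truncn_gt0; lra.
have m1 : 0 < m%:R :> R by rewrite ltr0n.
have [] := @tester_of_cover R n d k (m ^ d) eps _
  (fun f => [ffun b => coarse n0 m0 f b]) n0 _ eps0 eps1.
- by rewrite expn_gt0 m0.
- move=> f g fk gk /ffunP fg.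
  apply: le_trans (dist_block_constant R (n_gt0 := n0) (m_gt0 := m0) fk gk _) _.
    by move=> b; have := fg b; rewrite !ffunE.
  (* It remains to see [4 * x <= m], which holds as [m > 5 * x - 1] and [x >= 1]. *)
  rewrite ler_pdivrMr // -ler_pdivrMl ?divr_gt0 //.
  have -> : (eps / 2)^-1 * (2 * (k * d)%:R) = 4 * x.
    by rewrite /x invf_div; field; rewrite gt_eqF.
  by lra.
- by rewrite card_ffun card_bool card_grid.
move=> q qm tester; exists q => //; apply: (le_trans qm).
rewrite ler_pM2l // ler_pM2r ?invr_gt0 // natrX xE.
by rewrite lerXn2r ?nnegrE ?ler0n.
Qed.

(** The two conditions make the rounding and the Fourier error at most [eps / 4] each. A signature
    takes [d * a + 1] bits for each of [(d * a + 1)^t] tuples and [k] levels. *)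
Lemma fourier_tester (R : realType) (n d k a t : nat) (eps : R) :
  (0 < n)%N -> (0 < d)%N -> (0 < k)%N -> (0 < a)%N -> (0 < t)%N ->
  0 < eps -> eps <= 1 ->
  8 * (k%:R * d%:R / eps) <= (2 ^ a)%:R ->
  8 * (k%:R * Num.sqrt (d * a)%:R / eps) <= t%:R ->
  exists2 q : nat, q%:R <= 241 * ((k * (d * a + 1) ^ t.+1)%:R / eps)
                 & has_tester n d k q eps.
Proof.
move=> n0 d0 k0 a0 t0 eps0 eps1 a_le t_le.
have [sig sigP] := @k_monotone_signature R n d k a t n0 d0 a0 t0.
apply: (tester_of_cover (sig := sig)) => //.
- by rewrite muln_gt0 k0 expn_gt0 addn1.
- move=> f g fk gk fg; apply: le_trans (sigP f g fk gk fg) _.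
  have A0 : 0 < (2 ^ a)%:R :> R by rewrite ltr0n expn_gt0.
  have T0 : 0 < t%:R :> R by rewrite ltr0n.
  have bound (y z : R) : 0 < z -> 8 * (k%:R * y / eps) <= z ->
      k%:R * (2 * y / z) <= eps / 4.
    move=> z0; rewrite mulrA ler_pdivrMr // => yz.
    by rewrite mulrA ler_pdivrMr //; lra.
  have := bound _ _ A0 a_le; have := bound _ _ T0 t_le; rewrite mulrDr; lra.
rewrite !card_ffun card_option card_prod !card_ord -expnM.
apply: (@leq_trans ((2 ^ (d * a + 1)) ^ ((d * a).+1 ^ t * k))%N).
  rewrite leq_exp2r ?muln_gt0 ?expn_gt0 ?k0 //.
  by rewrite addn1 expnS mul2n -addnn -addn1 leq_add2l expn_gt0.
by rewrite -expnM addn1 expnS mulnA mulnC.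
Qed.

(** The squared logarithm is at least [1/4], and [1032 / 4 = 258] exceeds 241. *)
Lemma grid_bound_numeric (R : realType) (g y : R) : 2 <= g -> y <= 241 * g ->
  y <= softO_bound 1032 2 g.
Proof.
move=> g2 yg; apply: (le_trans yg); rewrite /softO_bound.
have L1 : 1 / 2 <= ln (2 + g).
  rewrite -[leLHS]expRK ler_ln ?posrE ?expR_gt0 //; last lra.
  by have := expR_half_le2 R; lra.
have : 1 / 4 <= ln (2 + g) ^+ 2 by rewrite expr2; nra.
by move=> h; nra.
Qed.

Lemma le_powR2 (R : realType) (x : R) : 0 <= x -> expR (x / 2) <= 2 `^ x.
Proof.
move=> x0; rewrite mulrC -[2^-1]mul1r expRM ge0_ler_powR ?nnegrE ?expR_ge0 //.
exact: expR_half_le2.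
Qed.

(* With G = 2 + g and L = ln G, every factor is at most a power of G = exp L,
   and the exponent t + 1 is O(g L). *)
Lemma fourier_bound_numeric (R : realType) (d k : nat) (eps : R) :
  (0 < d)%N -> (0 < k)%N -> 0 < eps -> eps <= 1 ->
  exists a t : nat, [/\ (0 < a)%N, (0 < t)%N,
    8 * (k%:R * d%:R / eps) <= (2 ^ a)%:R,
    8 * (k%:R * Num.sqrt (d * a)%:R / eps) <= t%:R &
    241 * ((k * (d * a + 1) ^ t.+1)%:R / eps)
    <= 2 `^ (softO_bound 1032 2 (k%:R * Num.sqrt d%:R / eps ^+ 2))].
Proof.
move=> d0 k0 eps0 eps1.
set sd := Num.sqrt d%:R; set g := k%:R * sd / eps ^+ 2.
have sd1 : 1 <= sd by rewrite -sqrtr1 ler_wsqrtr // ler1n.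
have sd2 : sd ^+ 2 = d%:R by rewrite sqr_sqrtr.
have k1 : 1 <= k%:R :> R by rewrite ler1n.
have ie1 : 1 <= eps^-1 by rewrite invf_ge1.
set ie := eps^-1 in ie1 *.
have gE : g = k%:R * sd * ie ^+ 2 by rewrite /g exprVn.
have ie2 : ie <= ie ^+ 2 by rewrite expr2; nra.
have ksd1 : 1 <= k%:R * sd by nra.
have kse_g : k%:R * sd * ie <= g by rewrite gE ler_pM2l //; lra.
have ks_kse : k%:R * sd <= k%:R * sd * ie by nra.
have g1 : 1 <= g by lra.
have s_g : sd <= g by nra.
have ke_g : k%:R * ie <= g.
  apply: le_trans kse_g; rewrite mulrAC ler_peMr //; nra.
set L := ln (2 + g).
have GE : expR L = 2 + g by rewrite lnK // posrE; lra.
have L1 : 1 / 2 <= L.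
  rewrite -[leLHS]expRK ler_ln ?posrE ?expR_gt0 //; last lra.
  by have := expR_half_le2 R; lra.
have LG : L <= 2 + g by rewrite ltW // ln_sublinear //; lra.
set G := 2 + g in GE LG.
have gG : g <= G by rewrite lerDr.
have G3 : 3 <= G by rewrite /G; lra.
have G0 : 0 <= G by apply: le_trans G3.
have sd0 : 0 <= sd by apply: le_trans sd1.
(* Then [2^a >= exp (a/2) >= G^4 >= 8 * g^2]. *)
pose a := (Num.trunc (8 * L)).+1.
have aL0 : 0 <= 8 * L by lra.
have /andP[a_le a_gt] := truncn_itv aL0; rewrite -/a in a_gt.
have {}a_le : a%:R <= 10 * L by rewrite /a -natr1; lra.
have a1 : 1 <= a%:R :> R by rewrite ler1n.
(* The crude bound [sqrt a <= a] costs only a logarithmic factor. *)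
pose t := (Num.trunc (8 * (k%:R * sd * ie * a%:R))).+1.
have tL0 : 0 <= 8 * (k%:R * sd * ie * a%:R) by rewrite !mulr_ge0 // (le_trans ler01).
have /andP[t_le t_gt] := truncn_itv tL0; rewrite -/t in t_gt.
have gL : 1 / 2 <= g * L by nra.
have {}t_le : t.+1%:R <= 84 * (g * L).
  rewrite -natr1 /t -natr1.
  have : k%:R * sd * ie * a%:R <= g * (10 * L) by rewrite ler_pM //; lra.
  by lra.
exists a, t; split=> //.
- apply: (@le_trans _ _ (expR (a%:R / 2))); last first.
    have -> : (2 ^ a)%:R = 2 `^ a%:R :> R by rewrite powR_mulrn // natrX.
    exact: le_powR2.
  apply: (@le_trans _ _ (expR (4 * L))); last by rewrite ler_expR; lra.
  rewrite expRM_natl GE.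
  have -> : k%:R * d%:R / eps = sd * (k%:R * sd * ie) by rewrite -sd2 -/ie; ring.
  have : sd * (k%:R * sd * ie) <= g * g by rewrite ler_pM //; lra.
  by move=> h; rewrite /G; nra.
- apply: le_trans (ltW t_gt); rewrite natrM sqrtrM // -/sd -/ie.
  rewrite ler_pM2l // mulrA mulrAC ler_pM2l; last by nra.
  rewrite -[leRHS]ger0_norm // -sqrtr_sqr ler_wsqrtr // expr2; nra.
have dG : d%:R <= G ^+ 2 by rewrite -sd2 lerXn2r ?nnegrE // (le_trans s_g).
have Da : (d * a + 1)%:R <= G ^+ 6 :> R.
  rewrite natrD natrM.
  have da : d%:R * a%:R <= G ^+ 2 * (10 * G) by rewrite ler_pM //; lra.
  have G27 : 27 <= G ^+ 3.
    by apply: (@le_trans _ _ (3 ^+ 3)); [lra | rewrite lerXn2r ?nnegrE].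
  have G6 : 27 * G ^+ 3 <= G ^+ 6.
    by rewrite (exprD G 3 3) ler_wpM2r ?exprn_ge0.
  have G3E : G ^+ 2 * (10 * G) = 10 * G ^+ 3 by ring.
  by rewrite G3E in da; lra.
rewrite natrM natrX.
apply: (@le_trans _ _ (G ^+ 5 * (G * (G ^+ 6) ^+ t.+1))).
  have G5 : 241 <= G ^+ 5.
    apply: (@le_trans _ _ (3 ^+ 5)); first by rewrite -natrX ler_nat.
    by rewrite lerXn2r ?nnegrE.
  have X0 : 0 <= (d * a + 1)%:R ^+ t.+1 :> R by rewrite exprn_ge0.
  have ke0 : 0 <= k%:R * ie by rewrite mulr_ge0 // (le_trans ler01).
  rewrite -/ie mulrAC; apply: ler_pM => //; first exact: mulr_ge0.
  apply: ler_pM => //; first exact: le_trans gG.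
  by rewrite lerXn2r ?nnegrE ?exprn_ge0.
apply: le_trans (le_powR2 _); last first.
  by rewrite /softO_bound mulr_ge0 ?sqr_ge0 // mulr_ge0 // (le_trans ler01).
rewrite (_ : _ * _ = G ^+ (6 + 6 * t.+1)); last by rewrite -exprM -exprS -exprD.
rewrite -GE -expRM_natl ler_expR /softO_bound -/L natrD natrM.
(* Here [516 = 6 * 84 + 12], with 6 absorbed by [g * L >= 1/2]; passing from [exp] to base 2 doubles
   it to 1032. *)
have : (6 + 6 * t.+1%:R) * L <= (516 * (g * L)) * L by rewrite ler_pM2r //; lra.
by move=> h; rewrite expr2; lra.
Qed.

Theorem theorem1p7 (R : realType) :
  exists C c : nat,
  forall (n d k : nat) (eps : R),
    (0 < n)%N -> (0 < d)%N -> (0 < k)%N -> 0 < eps -> eps <= 1 ->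
    exists q : nat,
      (q%:R <= softO_bound C c (eps ^- 2 * ((5 * k * d)%:R / eps) ^+ d)
       /\ q%:R <= 2 `^ (softO_bound C c (k%:R * Num.sqrt d%:R / eps ^+ 2)))
      /\ exists (Omega : finType) (w : Omega -> R)
                (Q : Omega -> 'I_q -> grid n d)
                (D : Omega -> {ffun 'I_q -> bool} -> bool),
           is_nonadaptive_kmono_tester k eps w Q D.
Proof.
exists 1032%N, 2%N => n d k eps n0 d0 k0 eps0 eps1.
have [q1 q1_le T1] := block_tester n0 d0 k0 eps0 eps1.
have [a [t [a0 t0 a_le t_le q2_num]]] := fourier_bound_numeric d0 k0 eps0 eps1.
have [q2 q2_le T2] := fourier_tester n0 d0 k0 a0 t0 eps0 eps1 a_le t_le.
have ie1 : 1 <= eps^-1 by rewrite invf_ge1.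
set y := (5 * k * d)%:R / eps in q1_le *.
have y5 : 5 <= y.
  have kd5 : 5 <= (5 * k * d)%:R :> R by rewrite ler_nat -mulnA leq_pmulr // muln_gt0 k0.
  by apply: (le_trans kd5); rewrite ler_peMr // (le_trans _ kd5).
have yd5 : 5 <= y ^+ d by rewrite (le_trans y5) // ler_eXnr // (le_trans _ y5) // ler1n.
have {}q1_le : q1%:R <= softO_bound 1032 2 (eps ^- 2 * y ^+ d).
  have yd0 : 0 <= y ^+ d by apply: le_trans yd5.
  (* The block tester spends a single factor [1 / eps], so [eps <= 1] leaves room. *)
  have y_le : y ^+ d / eps <= eps ^- 2 * y ^+ d.
    by rewrite mulrC ler_wpM2r // -exprVn ler_eXnr.
  apply: grid_bound_numeric; last by rewrite (le_trans q1_le) // ler_pM2l.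
  apply: le_trans y_le; apply: (@le_trans _ _ (y ^+ d)); last by rewrite ler_peMr.
  by apply: le_trans yd5; rewrite ler_nat.
have {}q2_le := le_trans q2_le q2_num.
have [q12|q21] := leqP q1 q2.
  by exists q1; split=> //; split=> //; apply: le_trans q2_le; rewrite ler_nat.
exists q2; split=> //; split=> //; apply: le_trans q1_le.
by rewrite ler_nat ltnW.
Qed.
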